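(* Let $n$ be a positive integer, let $R$ and $S$ be rings and let $f:R\to S$ be a ring monomorphism. Then $MC_n(f):MC_n(R)\to MC_n(S)$ is a ring monomorphism.
   Context: All rings are associative with $1$; ring morphisms preserve $1$; $\mathfrak{R}$ is the category of rings. $M_m(R)$ is the ring of $m\times m$ matrices over $R$, and for a ring morphism $f:R\to S$, $M_m(f):M_m(R)\to M_m(S)$ applies $f$ entrywise. For $n\ge 1$ let $\eta^n_R:R\to M_n(R)$, $\eta^n_R(a)_{ij}=a\delta_{ij}$ (scalar matrices). Identify $M_n(M_{n^k}(R))$ with $M_{n^{k+1}}(R)$ via block matrices. For $n$ fixed, consider the direct system indexed by $k\in\mathbb{N}=\{0,1,2,\dots\}$ with objects $M_{n^k}(R)$ (so $M_{n^0}(R)=R$) and connecting maps $\eta^n_{M_{n^k}(R)}:M_{n^k}(R)\to M_{n^{k+1}}(R)$ (sending $A$ to the block diagonal matrix with $n$ diagonal blocks equal to $A$) and their composites. The $n$-matricial closure $MC_n(R)$ is the direct limit of this system in $\mathfrak{R}$, with canonical morphisms $i[R]^n_k:M_{n^k}(R)\to MC_n(R)$. For a ring morphism $f:R\to S$, $MC_n(f):MC_n(R)\to MC_n(S)$ is the unique ring morphism with $MC_n(f)\circ i[R]^n_k=i[S]^n_k\circ M_{n^k}(f)$ for all $k\in\mathbb{N}$. *)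

(* Defs.v *)
From HB Require Import structures.
From mathcomp Require Import all_boot all_algebra generic_quotient.
From mathcomp Require Import boolp.

Set Implicit Arguments.
Unset Strict Implicit.
Unset Printing Implicit Defensive.
Import GRing.Theory.
Local Open Scope ring_scope.
Local Open Scope quotient_scope.

(* Rings are [pzRingType]: associative, unital, not necessarily commutative,   *)
(* the zero ring allowed. A ring monomorphism is an injective ring morphism;   *)
(* [ring_monoP] checks that this agrees with left cancellability among rings. *)
Section RingMono.
Variables (R S : pzRingType) (f : {rmorphism R -> S}).

Definition kerpair : {pred (R * R)%type} := [pred x | f x.1 == f x.2].

Fact kerpair_subring : subring_closed kerpair.
Proof.
split=> [|x y|x y]; rewrite !inE /= ?rmorph1 //.
  by move=> /eqP ex /eqP ey; rewrite !rmorphB /= ex ey.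
by move=> /eqP ex /eqP ey; rewrite !rmorphM /= ex ey.
Qed.

HB.instance Definition _ := GRing.isSubringClosed.Build _ kerpair kerpair_subring.

Record kerpair_type := KerPair { kval :> (R * R)%type; _ : kval \in kerpair }.
HB.instance Definition _ := [isSub for kval].
HB.instance Definition _ := [Choice of kerpair_type by <:].
HB.instance Definition _ := GRing.SubChoice_isSubPzRing.Build _ _ kerpair_type kerpair_subring.

Lemma ring_monoP :
  injective f <->
  (forall (T : pzRingType) (g h : {rmorphism T -> R}), f \o g =1 f \o h -> g =1 h).
Proof.
split=> [finj T g h e t|mono x y exy]; first exact/finj/e.
have xyk : (x, y) \in kerpair by rewrite inE /= exy.
pose g : {rmorphism kerpair_type -> R} := fst \o (val : kerpair_type -> _).
pose h : {rmorphism kerpair_type -> R} := snd \o (val : kerpair_type -> _).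
by apply: (mono _ g h _ (KerPair xyk)) => -[z /= /eqP].
Qed.

End RingMono.

Section DirectLimit.
Variables (A : nat -> pzRingType) (phi : forall k, {rmorphism A k -> A k.+1}).

Definition dl_pre := {k : nat & (A k : choiceType)}.
HB.instance Definition _ := Choice.on dl_pre.

Definition dl_in k (a : A k) : dl_pre := Tagged (fun k => A k : choiceType) a.

Definition dl_step (x : dl_pre) : dl_pre := dl_in (phi (tag x) (tagged x)).

(* Elements of the disjoint union are identified when they eventually become   *)
(* equal; this includes reaching the same stage.                               *)
Definition dl_rel (x y : dl_pre) : bool :=
  `[< exists p q, iter p dl_step x = iter q dl_step y >].

Fact dl_rel_refl : reflexive dl_rel.
Proof. by move=> x; apply/asboolP; exists 0%N, 0%N. Qed.

Fact dl_rel_sym : symmetric dl_rel.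
Proof.
by move=> x y; apply/asboolP/asboolP=> -[p [q e]]; exists q, p.
Qed.

Fact dl_rel_trans : transitive dl_rel.
Proof.
move=> y x z /asboolP[p [q e1]] /asboolP[r [s e2]]; apply/asboolP.
exists (r + p)%N, (q + s)%N.
by rewrite !iterD e1 -e2 -!iterD addnC.
Qed.

Canonical dl_equiv := EquivRel dl_rel dl_rel_refl dl_rel_sym dl_rel_trans.

Definition dirlim := {eq_quot dl_rel}.
HB.instance Definition _ : EqQuotient _ dl_rel dirlim := EqQuotient.on dirlim.
HB.instance Definition _ := Choice.on dirlim.

Definition dl_inj k (a : A k) : dirlim := \pi_dirlim (dl_in a).

Fixpoint dl_push k d : A k -> A (d + k)%N :=
  if d is d'.+1 then phi (d' + k) \o @dl_push k d' else id.

Definition dl_trans k l (le_kl : (k <= l)%N) (a : A k) : A l :=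
  ecast i (A i) (subnK le_kl) (dl_push (l - k) a).

Fact dl_in_inj k : injective (@dl_in k).
Proof. by move=> a b /eqP; rewrite -tag_eqE /tag_eq eqxx tagged_asE => /eqP. Qed.

Fact dl_in_push k d (a : A k) : dl_in (dl_push d a) = iter d dl_step (dl_in a).
Proof. by elim: d => //= d <-. Qed.

Fact dl_in_trans k l (le_kl : (k <= l)%N) (a : A k) :
  dl_in (dl_trans le_kl a) = iter (l - k) dl_step (dl_in a).
Proof. by rewrite -dl_in_push /dl_trans; move: (l - k)%N (subnK le_kl) => d e; case: l / e le_kl. Qed.

Fact dl_push_is_zmod_morphism k d : zmod_morphism (@dl_push k d).
Proof. elim: d => [//|d IH] a b.
by rewrite -[LHS]/(phi _ (dl_push d (a - b))) [dl_push d _]IH rmorphB. Qed.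

Fact dl_push_is_monoid_morphism k d : monoid_morphism (@dl_push k d).
Proof.
elim: d => [//|d [IH1 IHM]]; split=> [|a b].
  by rewrite -[LHS]/(phi _ (dl_push d 1)) IH1 rmorph1.
by rewrite -[LHS]/(phi _ (dl_push d (a * b))) IHM rmorphM.
Qed.

Fact dl_trans_is_zmod_morphism k l le_kl : zmod_morphism (@dl_trans k l le_kl).
Proof.
move=> a b; rewrite /dl_trans; move: (l - k)%N (subnK le_kl) => d e; case: l / e le_kl => _ /=.
exact: dl_push_is_zmod_morphism.
Qed.

Fact dl_trans_is_monoid_morphism k l le_kl : monoid_morphism (@dl_trans k l le_kl).
Proof.
rewrite /dl_trans; move: (l - k)%N (subnK le_kl) => d e; case: l / e le_kl => _ /=.
exact: dl_push_is_monoid_morphism.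
Qed.

HB.instance Definition _ k l le_kl :=
  GRing.isZmodMorphism.Build (A k) (A l) (dl_trans le_kl)
    (dl_trans_is_zmod_morphism le_kl).
HB.instance Definition _ k l le_kl :=
  GRing.isMonoidMorphism.Build (A k) (A l) (dl_trans le_kl)
    (dl_trans_is_monoid_morphism le_kl).

Lemma dl_trans_comp k l m (le_kl : (k <= l)%N) (le_lm : (l <= m)%N)
    (le_km : (k <= m)%N) (a : A k) :
  dl_trans le_lm (dl_trans le_kl a) = dl_trans le_km a.
Proof. by apply: dl_in_inj; rewrite !dl_in_trans -iterD addnBA // subnK. Qed.

Lemma dl_trans_id k (le_kk : (k <= k)%N) (a : A k) : dl_trans le_kk a = a.
Proof. by apply: dl_in_inj; rewrite dl_in_trans subnn. Qed.

Lemma dl_trans_succ k (le_k : (k <= k.+1)%N) (a : A k) : dl_trans le_k a = phi k a.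
Proof. by apply: dl_in_inj; rewrite dl_in_trans subSnn. Qed.

Lemma dl_inj_trans k l (le_kl : (k <= l)%N) (a : A k) :
  dl_inj (dl_trans le_kl a) = dl_inj a.
Proof.
apply/eqmodP/asboolP; exists 0%N, (l - k)%N.
by rewrite -dl_in_trans.
Qed.

Lemma dl_inj_phi k (a : A k) : dl_inj (phi k a) = dl_inj a.
Proof. by rewrite -(dl_trans_succ (leqnSn k)) dl_inj_trans. Qed.

Lemma dl_injP k l (a : A k) (b : A l) :
  dl_inj a = dl_inj b <->
  exists m (le_km : (k <= m)%N) (le_lm : (l <= m)%N),
    dl_trans le_km a = dl_trans le_lm b.
Proof.
split=> [/eqmodP/asboolP[p [q e]]|[m [km [lm e]]]]; last first.
  by rewrite -(dl_inj_trans km) e dl_inj_trans.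
have tagE r x : tag (iter r dl_step x) = (r + tag x)%N by elim: r => //= r ->.
have /= em : (p + k = q + l)%N by have := congr1 tag e; rewrite !tagE.
have km : (k <= p + k)%N := leq_addl p k.
have lm : (l <= p + k)%N by rewrite em leq_addl.
exists (p + k)%N, km, lm; apply: dl_in_inj.
by rewrite !dl_in_trans addnK em addnK.
Qed.

Fact dl_inj_repr (x : dirlim) : dl_inj (tagged (repr x)) = x.
Proof. by rewrite -[RHS]reprK /dl_inj; case: (repr x). Qed.

Lemma dl_injW (x : dirlim) : exists k (a : A k), x = dl_inj a.
Proof.
by exists (tag (repr x)), (tagged (repr x)); rewrite dl_inj_repr.
Qed.

Lemma dl_injW_ge (x : dirlim) :
  exists k, forall l, (k <= l)%N -> exists a : A l, x = dl_inj a.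
Proof.
have [k [a ->]] := dl_injW x; exists k => l kl.
by exists (dl_trans kl a); rewrite dl_inj_trans.
Qed.

Lemma dl_injW2 (x y : dirlim) : exists k (a b : A k), x = dl_inj a /\ y = dl_inj b.
Proof.
have [[k hx] [l hy]] := (dl_injW_ge x, dl_injW_ge y).
have [a xa] := hx (k + l)%N (leq_addr _ _).
have [b yb] := hy (k + l)%N (leq_addl _ _).
by exists (k + l)%N, a, b.
Qed.

Lemma dl_injW3 (x y z : dirlim) :
  exists k (a b c : A k), [/\ x = dl_inj a, y = dl_inj b & z = dl_inj c].
Proof.
have [k [a [b [-> ->]]]] := dl_injW2 x y; have [l hz] := dl_injW_ge z.
have [c zc] := hz (k + l)%N (leq_addl _ _).
exists (k + l)%N, (dl_trans (leq_addr _ _) a), (dl_trans (leq_addr _ _) b), c.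
by rewrite !dl_inj_trans.
Qed.

Definition dl_op (op : forall k, A k -> A k -> A k) (x y : dirlim) : dirlim :=
  let u := repr x in let v := repr y in
  dl_inj (op (maxn (tag u) (tag v))
             (dl_trans (leq_maxl _ _) (tagged u)) (dl_trans (leq_maxr _ _) (tagged v))).

Definition dl_zero : dirlim := dl_inj (0 : A 0%N).
Definition dl_one : dirlim := dl_inj (1 : A 0%N).
Definition dl_add := dl_op (fun k => +%R).
Definition dl_mul := dl_op (fun k => *%R).
Definition dl_opp (x : dirlim) : dirlim := dl_inj (- tagged (repr x)).

Fact dl_op_inj (op : forall k, A k -> A k -> A k) :
  (forall k l (le_kl : (k <= l)%N) a b,
     dl_trans le_kl (op k a b) = op l (dl_trans le_kl a) (dl_trans le_kl b)) ->
  forall k (a b : A k), dl_op op (dl_inj a) (dl_inj b) = dl_inj (op k a b).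
Proof.
move=> opE k a b; rewrite /dl_op.
have := dl_inj_repr (dl_inj a).
have := dl_inj_repr (dl_inj b).
case: (repr (dl_inj a)) => ku u; case: (repr (dl_inj b)) => kv v /=.
move=> /dl_injP[m [vm [km ev]]] /dl_injP[m' [um [km' eu]]].
apply/dl_injP; pose M := (m + m')%N.
have mM : (m <= M)%N := leq_addr _ _.
have mM' : (m' <= M)%N := leq_addl _ _.
have uvM : (maxn ku kv <= M)%N.
  by rewrite geq_max (leq_trans um mM') (leq_trans vm mM).
have kM := leq_trans km mM.
exists M, uvM, kM; rewrite !opE.
rewrite (dl_trans_comp _ _ (leq_trans um mM')) (dl_trans_comp _ _ (leq_trans vm mM)).
rewrite -(dl_trans_comp um mM') eu -(dl_trans_comp vm mM) ev.
by rewrite !(dl_trans_comp _ _ kM).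
Qed.

Fact dl_injD k (a b : A k) : dl_add (dl_inj a) (dl_inj b) = dl_inj (a + b).
Proof. by apply: dl_op_inj => *; rewrite rmorphD. Qed.

Fact dl_injM k (a b : A k) : dl_mul (dl_inj a) (dl_inj b) = dl_inj (a * b).
Proof. by apply: dl_op_inj => *; rewrite rmorphM. Qed.

Fact dl_injN k (a : A k) : dl_opp (dl_inj a) = dl_inj (- a).
Proof.
rewrite /dl_opp.
have := dl_inj_repr (dl_inj a).
case: (repr (dl_inj a)) => ku u /= /dl_injP[m [um [km e]]].
by apply/dl_injP; exists m, um, km; rewrite rmorphN /= e -rmorphN.
Qed.

Fact dl_inj0 k : dl_inj (0 : A k) = dl_zero.
Proof. by rewrite -[RHS](dl_inj_trans (leq0n k)) rmorph0. Qed.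

Fact dl_inj1 k : dl_inj (1 : A k) = dl_one.
Proof. by rewrite -[RHS](dl_inj_trans (leq0n k)) rmorph1. Qed.

Fact dl_addA : associative dl_add.
Proof.
move=> x y z; have [k [a [b [c [-> -> ->]]]]] := dl_injW3 x y z.
by rewrite !dl_injD addrA.
Qed.

Fact dl_addC : commutative dl_add.
Proof.
by move=> x y; have [k [a [b [-> ->]]]] := dl_injW2 x y; rewrite !dl_injD addrC.
Qed.

Fact dl_add0 : left_id dl_zero dl_add.
Proof.
by move=> x; have [k [a ->]] := dl_injW x; rewrite -(dl_inj0 k) dl_injD add0r.
Qed.

Fact dl_addN : left_inverse dl_zero dl_opp dl_add.
Proof.
move=> x; have [k [a ->]] := dl_injW x.
by rewrite dl_injN dl_injD addNr dl_inj0.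
Qed.

HB.instance Definition _ :=
  GRing.isZmodule.Build dirlim dl_addA dl_addC dl_add0 dl_addN.

Fact dl_injDE k (a b : A k) : dl_inj a + dl_inj b = dl_inj (a + b).
Proof. exact: dl_injD. Qed.

Fact dl_mulA : associative dl_mul.
Proof.
move=> x y z; have [k [a [b [c [-> -> ->]]]]] := dl_injW3 x y z.
by rewrite !dl_injM mulrA.
Qed.

Fact dl_mul1 : left_id dl_one dl_mul.
Proof.
by move=> x; have [k [a ->]] := dl_injW x; rewrite -(dl_inj1 k) dl_injM mul1r.
Qed.

Fact dl_mulr1 : right_id dl_one dl_mul.
Proof.
by move=> x; have [k [a ->]] := dl_injW x; rewrite -(dl_inj1 k) dl_injM mulr1.
Qed.

Fact dl_mulDl : left_distributive dl_mul +%R.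
Proof.
move=> x y z; have [k [a [b [c [-> -> ->]]]]] := dl_injW3 x y z.
by rewrite !dl_injM !dl_injDE dl_injM mulrDl.
Qed.

Fact dl_mulDr : right_distributive dl_mul +%R.
Proof.
move=> x y z; have [k [a [b [c [-> -> ->]]]]] := dl_injW3 x y z.
by rewrite !dl_injM !dl_injDE dl_injM mulrDr.
Qed.

HB.instance Definition _ := GRing.Zmodule_isPzRing.Build dirlim
  dl_mulA dl_mul1 dl_mulr1 dl_mulDl dl_mulDr.

Fact dl_inj_is_zmod_morphism k : zmod_morphism (@dl_inj k).
Proof. by move=> a b; rewrite -dl_injD -dl_injN. Qed.

Fact dl_inj_is_monoid_morphism k : monoid_morphism (@dl_inj k).
Proof. by split=> [|a b]; rewrite ?dl_inj1 // -dl_injM. Qed.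

HB.instance Definition _ k :=
  GRing.isZmodMorphism.Build (A k) dirlim (@dl_inj k) (@dl_inj_is_zmod_morphism k).
HB.instance Definition _ k :=
  GRing.isMonoidMorphism.Build (A k) dirlim (@dl_inj k)
    (@dl_inj_is_monoid_morphism k).

Definition dl_canon k : {rmorphism A k -> dirlim} := @dl_inj k.

Section Lift.
Variables (T : pzRingType) (g : forall k, {rmorphism A k -> T}).
Hypothesis g_phi : forall k (a : A k), g k.+1 (phi k a) = g k a.

(* The cocone condition is an argument only so that the lift can carry its     *)
(* ring morphism structure.                                                    *)
Definition dl_lift (_ : forall k (a : A k), g k.+1 (phi k a) = g k a)
  (x : dirlim) : T := g (tag (repr x)) (tagged (repr x)).

Fact cocone_trans k l (le_kl : (k <= l)%N) (a : A k) :
  g l (dl_trans le_kl a) = g k a.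
Proof.
rewrite /dl_trans; move: (l - k)%N (subnK le_kl) => d e; case: l / e le_kl => _ /=.
by elim: d => [//|d <-]; apply: g_phi.
Qed.

Lemma dl_lift_inj k (a : A k) : dl_lift g_phi (dl_inj a) = g k a.
Proof.
rewrite /dl_lift.
have := dl_inj_repr (dl_inj a).
by move=> /dl_injP[m [um [km e]]]; rewrite -(cocone_trans um) e cocone_trans.
Qed.

Fact dl_lift_is_zmod_morphism : zmod_morphism (dl_lift g_phi).
Proof.
move=> x y; have [k [a [b [-> ->]]]] := dl_injW2 x y.
by rewrite -rmorphB !dl_lift_inj rmorphB.
Qed.

Fact dl_lift_is_monoid_morphism : monoid_morphism (dl_lift g_phi).
Proof.
split=> [|x y]; first by rewrite -(rmorph1 (@dl_inj 0%N)) dl_lift_inj rmorph1.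
have [k [a [b [-> ->]]]] := dl_injW2 x y.
by rewrite -rmorphM !dl_lift_inj rmorphM.
Qed.

HB.instance Definition _ :=
  GRing.isZmodMorphism.Build dirlim T (dl_lift g_phi) dl_lift_is_zmod_morphism.
HB.instance Definition _ :=
  GRing.isMonoidMorphism.Build dirlim T (dl_lift g_phi) dl_lift_is_monoid_morphism.

Definition dl_desc : {rmorphism dirlim -> T} := dl_lift g_phi.

Lemma dl_desc_canon k (a : A k) : dl_desc (dl_canon k a) = g k a.
Proof. exact: dl_lift_inj. Qed.

Lemma dl_desc_unique (h : {rmorphism dirlim -> T}) :
  (forall k (a : A k), h (dl_canon k a) = g k a) -> h =1 dl_desc.
Proof. by move=> hE x; have [k [a ->]] := dl_injW x; rewrite [LHS]hE [RHS]dl_lift_inj. Qed.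

End Lift.
End DirectLimit.

Section BlockMatrix.
Variables (R : pzRingType) (n m : nat).

Fact blk_row_subproof (i : 'I_(n * m)) : (i %/ m < n)%N.
Proof. by rewrite ltn_divLR ?ltn_ord //; case: m i => // -[i]; rewrite muln0. Qed.

Fact blk_col_subproof (i : 'I_(n * m)) : (i %% m < m)%N.
Proof. by rewrite ltn_mod; case: m i => // -[i]; rewrite muln0. Qed.

Definition blk_out (i : 'I_(n * m)) : 'I_n := Ordinal (blk_row_subproof i).
Definition blk_in (i : 'I_(n * m)) : 'I_m := Ordinal (blk_col_subproof i).

(* M_n(M_m(R)) -> M_(nm)(R): position i lies in block i %/ m, at offset i %% m. *)
Definition block_flatten (B : 'M['M[R]_m]_n) : 'M[R]_(n * m) :=
  \matrix_(i, j) B (blk_out i) (blk_out j) (blk_in i) (blk_in j).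

Fact blk_index_subproof (i : 'I_n) (j : 'I_m) : (i * m + j < n * m)%N.
Proof.
by rewrite (leq_trans _ (leq_mul (ltn_ord i) (leqnn m))) // mulSn addnC ltn_add2r.
Qed.

Definition blk_index i j : 'I_(n * m) := Ordinal (blk_index_subproof i j).

Fact blk_outK i j : blk_out (blk_index i j) = i.
Proof.
apply/val_inj; rewrite /= divnMDl; first by rewrite divn_small ?addn0.
by case: (m) j => [[]|].
Qed.

Fact blk_inK i j : blk_in (blk_index i j) = j.
Proof. by apply/val_inj; rewrite /= modnMDl modn_small. Qed.

Fact blk_indexK k : blk_index (blk_out k) (blk_in k) = k.
Proof. by apply/val_inj; rewrite /= -divn_eq. Qed.

Fact block_flatten_is_zmod_morphism : zmod_morphism block_flatten.
Proof. by move=> B C; apply/matrixP=> i j; rewrite !mxE. Qed.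

Fact block_flatten_is_monoid_morphism : monoid_morphism block_flatten.
Proof.
split=> [|B C]; apply/matrixP=> i j; rewrite !mxE.
  rewrite -[i == j]/(val i == val j) -(blk_indexK i) -(blk_indexK j).
  rewrite !blk_outK !blk_inK.
  have -> : (val (blk_index (blk_out i) (blk_in i)) ==
             val (blk_index (blk_out j) (blk_in j))) =
            (blk_out i == blk_out j) && (blk_in i == blk_in j).
    apply/eqP/andP => [/val_inj e|[/eqP-> /eqP->] //].
    have := congr1 blk_out e; have := congr1 blk_in e.
    by rewrite !blk_outK !blk_inK => -> ->.
  by case: eqP => _; rewrite ?mxE ?mulr0n ?mulr1n ?mxE.
rewrite summxE (reindex (fun p : 'I_n * 'I_m => blk_index p.1 p.2)) /=; last first.
  exists (fun k => (blk_out k, blk_in k)) => [[x y] _|k _] /=.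
    by rewrite blk_outK blk_inK.
  exact: blk_indexK.
under [LHS]eq_bigr => x _ do rewrite mxE.
rewrite pair_big /=; apply: eq_bigr => -[x y] _ /=.
by rewrite !mxE blk_outK blk_inK.
Qed.

HB.instance Definition _ := GRing.isZmodMorphism.Build 'M['M[R]_m]_n 'M[R]_(n * m)
  block_flatten block_flatten_is_zmod_morphism.
HB.instance Definition _ := GRing.isMonoidMorphism.Build 'M['M[R]_m]_n 'M[R]_(n * m)
  block_flatten block_flatten_is_monoid_morphism.

End BlockMatrix.

Section MatricialClosure.
Variable n : nat.

Definition scalar_emb (R : pzRingType) (a : R) : 'M[R]_n := a%:M.

Fact scalar_emb_is_zmod_morphism (R : pzRingType) : zmod_morphism (@scalar_emb R).
Proof. by move=> a b; apply: raddfB. Qed.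

Fact scalar_emb_is_monoid_morphism (R : pzRingType) :
  monoid_morphism (@scalar_emb R).
Proof. by split=> // a b; apply: scalar_mxM. Qed.

HB.instance Definition _ (R : pzRingType) :=
  GRing.isZmodMorphism.Build R 'M[R]_n (@scalar_emb R)
    (@scalar_emb_is_zmod_morphism R).
HB.instance Definition _ (R : pzRingType) :=
  GRing.isMonoidMorphism.Build R 'M[R]_n (@scalar_emb R)
    (@scalar_emb_is_monoid_morphism R).

(* The stage R itself is represented by 1 x 1 matrices.                        *)
Definition mc_stage (R : pzRingType) (k : nat) : pzRingType := 'M[R]_(n ^ k).

Definition mc_step (R : pzRingType) k (A : mc_stage R k) : mc_stage R k.+1 :=
  castmx (esym (expnS n k), esym (expnS n k)) (block_flatten (scalar_emb A)).

Fact mc_step_is_zmod_morphism R k : zmod_morphism (@mc_step R k).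
Proof.
move=> A B; rewrite /mc_step /mc_stage; case: _ / (esym (expnS n k)) => /=.
by rewrite !castmx_id !rmorphB.
Qed.

Fact mc_step_is_monoid_morphism R k : monoid_morphism (@mc_step R k).
Proof.
rewrite /mc_step /mc_stage; case: _ / (esym (expnS n k)) => /=.
by split=> [|A B]; rewrite !castmx_id ?rmorph1 ?rmorphM.
Qed.

HB.instance Definition _ R k :=
  GRing.isZmodMorphism.Build (mc_stage R k) (mc_stage R k.+1) (@mc_step R k)
    (@mc_step_is_zmod_morphism R k).
HB.instance Definition _ R k :=
  GRing.isMonoidMorphism.Build (mc_stage R k) (mc_stage R k.+1) (@mc_step R k)
    (@mc_step_is_monoid_morphism R k).

Definition mc_eta (R : pzRingType) k : {rmorphism mc_stage R k -> mc_stage R k.+1} :=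
  @mc_step R k.

Definition MC (R : pzRingType) : pzRingType := dirlim (mc_eta R).

Definition MC_inj (R : pzRingType) k : {rmorphism 'M[R]_(n ^ k) -> MC R} :=
  dl_canon (mc_eta R) k.

Section Map.
Variables (R S : pzRingType) (f : {rmorphism R -> S}).

Fact mc_step_map k (A : 'M[R]_(n ^ k)) :
  mc_step (map_mx f A : mc_stage S k) = map_mx f (mc_step (A : mc_stage R k)).
Proof.
rewrite /mc_step map_castmx; congr castmx.
by apply/matrixP=> i j; rewrite !mxE; case: eqP; rewrite ?mulr1n ?mulr0n !mxE ?rmorph0.
Qed.

Definition MC_cocone k : {rmorphism 'M[R]_(n ^ k) -> MC S} :=
  @MC_inj S k \o (map_mx f : 'M[R]_(n ^ k) -> 'M[S]_(n ^ k)).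

Fact MC_cocone_step k (A : mc_stage R k) :
  MC_cocone k.+1 (mc_eta R k A) = MC_cocone k A.
Proof. by rewrite /= -mc_step_map; apply: (dl_inj_phi (mc_eta S)). Qed.

Definition MC_map : {rmorphism MC R -> MC S} := dl_desc MC_cocone_step.

Lemma MC_mapE k (A : 'M[R]_(n ^ k)) :
  MC_map (MC_inj R k A) = MC_inj S k (map_mx f A).
Proof. exact: dl_desc_canon. Qed.

Lemma MC_map_unique (h : {rmorphism MC R -> MC S}) :
  (forall k (A : 'M[R]_(n ^ k)), h (MC_inj R k A) = MC_inj S k (map_mx f A)) ->
  h =1 MC_map.
Proof. exact: (dl_desc_unique MC_cocone_step). Qed.

End Map.
End MatricialClosure.

(* Main.v *)
Require Import Defs.
From HB Require Import structures.
From mathcomp Require Import all_boot all_algebra.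

(* The maps [M_(n^k)(f)] are injective and commute with the connecting maps.   *)
(* If [MC_n(f)] identifies the classes of two matrices of the same stage, their *)
(* images under [f] agree at some later stage; cancelling [f] there makes the   *)
(* matrices themselves agree at that stage.                                     *)

Section DirectLimitMap.
Variables (A B : nat -> pzRingType).
Variables (phi : forall k, {rmorphism A k -> A k.+1}).
Variables (psi : forall k, {rmorphism B k -> B k.+1}).
Variables (h : forall k, A k -> B k).
Hypothesis h_phi : forall k (a : A k), psi k (h k a) = h k.+1 (phi k a).

(** Extends the one-step compatibility [h_phi] to arbitrary transition maps, by iterating it. *)
Lemma dl_trans_natural k l (le_kl : (k <= l)%N) (a : A k) :
  dl_trans psi le_kl (h k a) = h l (dl_trans phi le_kl a).
Proof.
(* Generalizing [l - k] to [d] lets matching on [e] remove the cast, leaving only [dl_push]. *)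
rewrite /dl_trans; move: (l - k)%N (subnK le_kl) => d e.
case: l / e le_kl => _ /=.
by elim: d => [//|d IH] /=; rewrite IH h_phi.
Qed.

(** Equality in the limit is witnessed at a finite stage, where naturality pulls [h] out of both
    transition maps. *)
Lemma dl_inj_mono k (a b : A k) :
    (forall l, injective (h l)) ->
  dl_inj psi (h k a) = dl_inj psi (h k b) -> dl_inj phi a = dl_inj phi b.
Proof.
move=> h_inj /dl_injP[m [le_am [le_bm]]].
rewrite !dl_trans_natural => /h_inj eq_ab.
by apply/dl_injP; exists m, le_am, le_bm.
Qed.

End DirectLimitMap.

Theorem proposition5 (n : nat) (n_gt0 : (0 < n)%N) (R S : pzRingType)
    (f : {rmorphism R -> S}) (f_mono : injective f) :
  injective (MC_map n f).
Proof.
(* A common stage [k] for both points reduces the claim to [dl_inj_mono]. *)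
move=> x y; have [k [a [b [-> ->]]]] := dl_injW2 x y.
rewrite [LHS](@MC_mapE n R S f k a) [RHS](@MC_mapE n R S f k b).
apply: (@dl_inj_mono _ _ _ _ (fun k (M : mc_stage n R k) => map_mx f M : mc_stage n S k)).
- by move=> l M; apply: mc_step_map.
- move=> l M N eq_MN; apply/matrixP=> i j; apply: f_mono.
  by move/matrixP/(_ i j): eq_MN; rewrite !mxE.
Qed.
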